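(* Let $n\ge 1$. Suppose that $(u_h^m,p_h^m,d_h^m,\lambda_h^m)\in V_h\times Q_h\times W_h\times\Lambda_h$ satisfy, for all $m=1,\dots,n$, $$\rho_f(\partial_\tau u_h^m,v_h)_{0,\Omega}+2\mu(\varepsilon(u_h^m),\varepsilon(v_h))_{0,\Omega}-(\operatorname{div}v_h,p_h^m)_{0,\Omega}+c(\lambda_h^m,v_h\circ\phi_h^{m-1})=0\quad\forall v_h\in V_h,$$ $$\rho_s\epsilon(\partial_{\tau\tau}d_h^m,w_h)_{0,\Sigma}+a^s(d_h^m,w_h)-c(\lambda_h^m,w_h)=0\quad\forall w_h\in W_h,$$ $$c(\mu_h,u_h^m\circ\phi_h^{m-1}-\partial_\tau d_h^m)=0\quad\forall\mu_h\in\Lambda_h,$$ $$(\operatorname{div}u_h^m,q_h)_{0,\Omega}+s_h(p_h^m,q_h)=0\quad\forall q_h\in Q_h,$$ where $\phi_h^m=\phi_0+d_h^m$ for $m\ge 0$, $u_h^0=u_{0h}\in V_h$, $d_h^0=d_{0h}\in W_h$, $d_h^{-1}=d_{0h}-\tau d_{1h}$ with $d_{1h}\in W_h$. Put $\dot d_h^k=\partial_\tau d_h^k$ for $k\ge 0$ and $$E_h^n=\tfrac{\rho_f}{2}\|u_h^n\|_{0,\Omega}^2+\tfrac{\rho_s\epsilon}{2}\|\dot d_h^n\|_{0,\Sigma}^2+\tfrac12\|d_h^n\|_s^2,$$ $$D_h^n=\tau\sum_{k=1}^n\Big(2\mu\|\varepsilon(u_h^k)\|_{0,\Omega}^2+|p_h^k|_{s_h}^2\Big)+\tau^2\sum_{k=1}^n\Big(\tfrac{\rho_f}{2}\|\partial_\tau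 u_h^k\|_{0,\Omega}^2+\tfrac{\rho_s\epsilon}{2}\|\partial_\tau\dot d_h^k\|_{0,\Sigma}^2+\tfrac12\|\partial_\tau d_h^k\|_s^2\Big).$$ Then $$E_h^n+D_h^n=E_h^0 .$$
   Context: Let $d\in\{2,3\}$, $\Omega\subset\mathbb R^d$ a polygonal domain, $\Sigma$ a fixed $(d-1)$-dimensional reference configuration (a polygonal domain, e.g. an interval if $d=2$), and $\phi_0:\Sigma\to\Omega$ the reference position map of an immersed thin solid. Constants $\rho_f,\rho_s,\epsilon,\mu>0$ (fluid density, solid density, solid thickness, viscosity). $(\cdot,\cdot)_{0,\Omega}$, $(\cdot,\cdot)_{0,\Sigma}$ are $L^2$ scalar products with norms $\|\cdot\|_{0,\Omega},\|\cdot\|_{0,\Sigma}$; $\varepsilon(u)=\frac12(\nabla u+\nabla u^T)$. $V=H^1_0(\Omega)^d$; $Q=L^2_0(\Omega)$ (zero-mean $L^2$ functions); $W\subset H^1(\Sigma)^d$ is the closed subspace of admissible solid displacements (encoding homogeneous Dirichlet conditions, if any). $a^s:W\times W\to\mathbb R$ is a symmetric bilinear form, continuous and coercive for the $H^1(\Sigma)$-norm, and $\|w\|_s=a^s(w,w)^{1/2}$. Discretization: $\{\mathcal T_h\}$ is a regular family of simplicial triangulations of $\Omega$ ($h_K$ the diameter of $K\in\mathcal T_h$), $\{\mathcal S_h\}$ a quasi-uniform family of simplicial triangulations of $\Sigma$. With $X_h$, $Y_h$ the spaces of continuous piecewise affine functions on $\mathcal T_h$, $\mathcal S_h$: $V_h=V\cap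 X_h^d$, $Q_h=Q\cap X_h$, $W_h=W\cap Y_h^d$, $\Lambda_h=Y_h^d$. On discrete functions $c(\cdot,\cdot)$ is the $L^2(\Sigma)^d$ scalar product. $s_h(p_h,q_h)=\gamma\sum_{K\in\mathcal T_h}h_K^2\int_K\nabla p_h\cdot\nabla q_h$ with a fixed $\gamma>0$, and $|q_h|_{s_h}^2=s_h(q_h,q_h)$. Time step $\tau>0$; $\partial_\tau g^n=(g^n-g^{n-1})/\tau$, $\partial_{\tau\tau}g^n=(g^n-2g^{n-1}+g^{n-2})/\tau^2$. It is assumed throughout that the solid stays in the fluid domain, i.e. $\phi_h^{m}(\Sigma)\subset\Omega$, so that $v_h\circ\phi_h^{m}$ is defined for $v_h\in V_h$. *)

(* Defs.v *)
(* Points of R^n are row vectors ['rV[R]_n]; a function defined on (the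
   closure of) a subset of R^n is represented by a total function, whose values
   elsewhere are never used. *)
From HB Require Import structures.
From mathcomp Require Import all_boot all_order all_algebra finmap.
From mathcomp Require Import all_classical all_reals all_analysis.

Set Implicit Arguments.
Unset Strict Implicit.
Unset Printing Implicit Defensive.

Import Order.TTheory GRing.Theory Num.Theory numFieldNormedType.Exports.

Local Open Scope classical_set_scope.
Local Open Scope ring_scope.

(* The sigma-algebra on R^n is the one generated by the coordinates, as in the
   library's instance for tuples; it is the Borel sigma-algebra. *)
Definition measure_rV_display : measure_display.
Proof. exact: default_measure_display. Qed.

Section measurable_rV.
Context {R : realType} (n : nat).

Definition coord_rV (i : 'I_n) (x : 'rV[R]_n) : measurableTypeR R := x 0 i.

Let rV_set0 : g_sigma_preimage coord_rV set0.
Proof. exact: sigma_algebra0. Qed.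

Let rV_setC A : g_sigma_preimage coord_rV A -> g_sigma_preimage coord_rV (~` A).
Proof. exact: sigma_algebraC. Qed.

Let rV_bigcup (F : _^nat) : (forall i, g_sigma_preimage coord_rV (F i)) ->
  g_sigma_preimage coord_rV (\bigcup_i (F i)).
Proof. exact: sigma_algebra_bigcup. Qed.

HB.instance Definition _ := @isMeasurable.Build measure_rV_display
  'rV[R]_n (g_sigma_preimage coord_rV) rV_set0 rV_setC rV_bigcup.

Lemma measurable_coord_rV (i : 'I_n) :
  measurable_fun [set: 'rV[R]_n] (coord_rV i).
Proof.
move=> _ Y mY; rewrite setTI; apply: sub_sigma_algebra => /=.
rewrite -bigcup_seq/=; exists i => /=; first by rewrite mem_index_enum.
by exists Y => //; rewrite setTI.
Qed.

Lemma measurable_fun_rV d (T : measurableType d) (f : T -> 'rV[R]_n) :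
  (forall i, measurable_fun [set: T] (coord_rV i \o f)) ->
  measurable_fun [set: T] f.
Proof.
move=> mf _ A mA; rewrite setTI.
suff sub : g_sigma_preimage coord_rV `<=` [set B | measurable (f @^-1` B)].
  exact: sub.
apply: smallest_sub.
  split; first by rewrite /= preimage_set0.
  - by move=> B /= mB; rewrite setTD preimage_setC; exact: measurableC.
  - move=> F mF; rewrite /= preimage_bigcup.
    by apply: bigcup_measurable => k _; exact: mF.
rewrite -bigcup_seq => B [i /= _] [C mC <-].
by rewrite setTI -comp_preimage -[X in measurable X]setTI; exact: mf.
Qed.

End measurable_rV.

(* Lebesgue measure on R^n, by recursion on n: a unit mass on R^0, and the image
   of the product of the Lebesgue measures of R and R^n under
   [(t, x) |-> row_mx t x] on R^(n+1). *)
Section lebesgue_rV.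
Context {R : realType}.

Definition cons_rV n (p : measurableTypeR R * 'rV[R]_n) : 'rV[R]_n.+1 :=
  row_mx (const_mx p.1 : 'rV[R]_1) p.2.

Definition uncons_rV n (x : 'rV[R]_n.+1) : measurableTypeR R * 'rV[R]_n :=
  (x 0 ord0, \row_i x 0 (lift ord0 i)).

Lemma cons_rV0 n p : @cons_rV n p 0 ord0 = p.1.
Proof.
have := row_mxEl (const_mx p.1 : 'rV[R]_1) p.2 0 ord0.
by rewrite [X in _ = X]mxE => <-; congr (cons_rV p _ _); exact/val_inj.
Qed.

Lemma cons_rVS n p i : @cons_rV n p 0 (lift ord0 i) = p.2 0 i.
Proof.
have <- := row_mxEr (const_mx p.1 : 'rV[R]_1) p.2 0 i.
by congr (cons_rV p _ _); exact/val_inj.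
Qed.

Lemma cons_rVK n : cancel (@cons_rV n) (@uncons_rV n).
Proof.
move=> p; rewrite /uncons_rV cons_rV0 [RHS]surjective_pairing; congr pair.
by apply/rowP => i; rewrite mxE cons_rVS.
Qed.

Lemma measurable_cons_rV n : measurable_fun [set: _] (@cons_rV n).
Proof.
apply: measurable_fun_rV => i; have [j ->|->] := unliftP ord0 i.
  rewrite (_ : _ \o _ = coord_rV j \o snd); last first.
    by apply/funext => p; exact: cons_rVS.
  by apply: measurableT_comp => //; exact: measurable_coord_rV.
rewrite (_ : _ \o _ = fst)//.
by apply/funext => p; exact: cons_rV0.
Qed.

Lemma measurable_uncons_rV n : measurable_fun [set: _] (@uncons_rV n).
Proof.
apply/measurable_fun_pair; first exact: measurable_coord_rV.
apply: measurable_fun_rV => i.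
rewrite (_ : _ \o _ = coord_rV (lift ord0 i)); first exact: measurable_coord_rV.
by apply/funext => x; rewrite /coord_rV /= mxE.
Qed.

Section step.
Variables (n : nat) (mu : {sigma_finite_measure set 'rV[R]_n -> \bar R}).

Definition lebesgue_rVS : set 'rV[R]_n.+1 -> \bar R :=
  pushforward (lebesgue_measure \x mu)%E (@cons_rV n).

Let mcons : measurable_fun [set: _] (@cons_rV n).
Proof. exact: measurable_cons_rV. Qed.

Let lebesgue_rVS0 : lebesgue_rVS set0 = 0%E.
Proof. exact: measure0. Qed.

Let lebesgue_rVS_ge0 A : (0 <= lebesgue_rVS A)%E.
Proof. exact: measure_ge0. Qed.

Let lebesgue_rVS_sigma_additive : semi_sigma_additive lebesgue_rVS.
Proof. exact: measure_semi_sigma_additive. Qed.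

HB.instance Definition _ := isMeasure.Build _ _ _ lebesgue_rVS
  lebesgue_rVS0 lebesgue_rVS_ge0 lebesgue_rVS_sigma_additive.

Lemma sigma_finite_lebesgue_rVS : sigma_finite [set: 'rV[R]_n.+1] lebesgue_rVS.
Proof.
have /sigma_finiteP[F [TF ndF Foo]] := sigma_finiteT (@lebesgue_measure R).
have /sigma_finiteP[G [TG ndG Goo]] := sigma_finiteT mu.
exists (fun k => @uncons_rV n @^-1` (F k `*` G k)).
  rewrite -preimage_bigcup (_ : \bigcup_k _ = setT) ?preimage_setT//.
  rewrite -setXTT TF TG predeqE => -[x y]; split.
    by move=> [k _ []/= ? ?]; split; exists k.
  move=> [/= [k _ Fkx] [l _ Gly]]; exists (maxn k l) => //; split.
  - by move: x Fkx; exact/subsetPset/ndF/leq_maxl.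
  - by move: y Gly; exact/subsetPset/ndG/leq_maxr.
move=> k; have [mF Fk] := Foo k; have [mG Gk] := Goo k; split.
  rewrite -[X in measurable X]setTI; apply: measurable_uncons_rV => //.
  exact: measurableX.
rewrite /lebesgue_rVS /pushforward (_ : _ @^-1` _ = F k `*` G k).
  by rewrite product_measure1E// lte_mul_pinfty// ge0_fin_numE.
rewrite -comp_preimage (_ : _ \o _ = id) ?preimage_id//.
exact/funext/cons_rVK.
Qed.

HB.instance Definition _ := Measure_isSigmaFinite.Build _ _ _ lebesgue_rVS
  sigma_finite_lebesgue_rVS.

End step.

Fixpoint lebesgue_rV (n : nat) :
  {sigma_finite_measure set 'rV[R]_n -> \bar R} :=
  match n with
  | 0 => dirac (0 : 'rV[R]_0)
  | n'.+1 => lebesgue_rVS (lebesgue_rV n')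
  end.

End lebesgue_rV.

Section sobolev.
Context {R : realType} {n : nat}.
Implicit Types (A Om : set 'rV[R]_n) (f g u phi : 'rV[R]_n -> R).

Definition L2prod A f g : R := \int[lebesgue_rV n]_(x in A) (f x * g x).

(* The scalar product of [L^2(A)] for vector- and matrix-valued functions. *)
Definition L2prodM (p q : nat) A (F G : 'rV[R]_n -> 'M[R]_(p, q)) : R :=
  \int[lebesgue_rV n]_(x in A) \sum_i \sum_j F x i j * G x i j.

Definition L2normM (p q : nat) A (F : 'rV[R]_n -> 'M[R]_(p, q)) : R :=
  Num.sqrt (L2prodM A F F).

Definition L2 A :=
  [set f : 'rV[R]_n -> R | measurable_fun A f /\
     (lebesgue_rV n).-integrable A (fun x => (f x ^+ 2)%:E)].

Definition pderiv (i : 'I_n) f : 'rV[R]_n -> R :=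
  fun x => 'D_(delta_mx 0 i) f x.

Definition smooth f : Prop :=
  forall (s : seq 'I_n) (x : 'rV[R]_n), differentiable (foldr pderiv f s) x.

(* [C_c^\infty(Om)] *)
Definition test_function Om :=
  [set phi : 'rV[R]_n -> R |
    [/\ smooth phi, compact (closure [set x | phi x != 0]) &
        closure [set x | phi x != 0] `<=` Om]].

Definition is_weak_pderiv Om (i : 'I_n) u g : Prop :=
  L2 Om g /\ forall phi, test_function Om phi ->
    L2prod Om u (pderiv i phi) = - L2prod Om g phi.

Definition H1 Om :=
  [set u : 'rV[R]_n -> R | L2 Om u /\
     forall i, exists g, is_weak_pderiv Om i u g].

(* A representative of the weak derivative, unique up to a null set. *)
Definition wpderiv Om (i : 'I_n) u : 'rV[R]_n -> R :=
  xget (fun=> 0) [set g : 'rV[R]_n -> R | is_weak_pderiv Om i u g].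

Definition grad Om u : 'rV[R]_n -> 'rV[R]_n :=
  fun x => \row_i wpderiv Om i u x.

Definition H1norm Om u : R :=
  Num.sqrt (L2prod Om u u + L2prodM Om (grad Om u) (grad Om u)).

(* [H^1_0(Om)], the closure of [C_c^\infty(Om)] in [H^1(Om)] *)
Definition H10 Om :=
  [set u : 'rV[R]_n -> R | H1 Om u /\ forall e : R, 0 < e ->
     exists2 phi, test_function Om phi & H1norm Om (u - phi) < e].

Definition L20 Om :=
  [set q : 'rV[R]_n -> R | L2 Om q /\ \int[lebesgue_rV n]_(x in Om) q x = 0].

Definition comp_rV (d : nat) (j : 'I_d) (v : 'rV[R]_n -> 'rV[R]_d) :
  'rV[R]_n -> R := fun x => v x 0 j.

(* [X^d] for a space [X] of scalar functions *)
Definition vspace (d : nat) (X : set ('rV[R]_n -> R)) :=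
  [set v : 'rV[R]_n -> 'rV[R]_d | forall j, X (comp_rV j v)].

Definition H1normV (d : nat) Om (v : 'rV[R]_n -> 'rV[R]_d) : R :=
  Num.sqrt (\sum_j H1norm Om (comp_rV j v) ^+ 2).

Definition strain Om (v : 'rV[R]_n -> 'rV[R]_n) : 'rV[R]_n -> 'M[R]_n :=
  fun x => \matrix_(i, j)
    (2^-1 * (wpderiv Om j (comp_rV i v) x + wpderiv Om i (comp_rV j v) x)).

Definition divergence Om (v : 'rV[R]_n -> 'rV[R]_n) : 'rV[R]_n -> R :=
  fun x => \sum_i wpderiv Om i (comp_rV i v) x.

(* Elements of [H^1] are represented by functions; closedness makes [W]
   invariant under equality almost everywhere. *)
Definition closed_subspace_H1 (d : nat) Om (W : set ('rV[R]_n -> 'rV[R]_d)) :=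
  [/\ W `<=` vspace (H1 Om),
      W 0,
      (forall (a : R) w z, W w -> W z -> W (a *: w + z)) &
      forall (w_ : nat -> 'rV[R]_n -> 'rV[R]_d) w, (forall k, W (w_ k)) ->
        vspace (H1 Om) w ->
        (fun k => H1normV Om (w_ k - w)) @ \oo --> (0 : R) -> W w].

Definition solid_form (d : nat) Om (W : set ('rV[R]_n -> 'rV[R]_d))
    (a_s : ('rV[R]_n -> 'rV[R]_d) -> ('rV[R]_n -> 'rV[R]_d) -> R) :=
  [/\ forall (a : R) w1 w2 z, W w1 -> W w2 -> W z ->
        a_s (a *: w1 + w2) z = a * a_s w1 z + a_s w2 z,
      forall w z, W w -> W z -> a_s w z = a_s z w,
      exists C : R, forall w z, W w -> W z ->
        `|a_s w z| <= C * H1normV Om w * H1normV Om z &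
      exists2 alpha : R, 0 < alpha & forall w, W w ->
        alpha * H1normV Om w ^+ 2 <= a_s w w].

End sobolev.

Section finite_elements.
Context {R : realType} {n : nat}.
Implicit Types (K L : {fset 'rV[R]_n}) (T : {fset {fset 'rV[R]_n}}).
Implicit Types (A Om : set 'rV[R]_n).

(* The norm of the library on ['rV[R]_n] is the sup norm. *)
Definition enorm (x : 'rV[R]_n) : R := Num.sqrt (\sum_i x 0 i ^+ 2).

Definition hull K : set 'rV[R]_n :=
  [set x | exists a : 'rV[R]_n -> R,
     [/\ forall v, v \in K -> 0 <= a v, \sum_(v <- K) a v = 1 &
         x = \sum_(v <- K) a v *: v]].

Definition affinely_independent K : Prop :=
  forall a : 'rV[R]_n -> R, \sum_(v <- K) a v = 0 ->
    \sum_(v <- K) a v *: v = 0 -> forall v, v \in K -> a v = 0.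

(* A simplex is given by its set of vertices, a mesh by its finite set of
   simplices. *)
Definition simplex K : Prop := #|` K| = n.+1 /\ affinely_independent K.

Definition union_hull T : set 'rV[R]_n :=
  [set x | exists2 K, K \in T & hull K x].

Definition polygonal_domain Om : Prop :=
  [/\ Om !=set0, open Om, connected Om, (closure Om)° = Om &
      exists T, (forall K, K \in T -> simplex K) /\ closure Om = union_hull T].

Definition triangulation Om T : Prop :=
  [/\ forall K, K \in T -> simplex K,
      union_hull T = closure Om &
      forall K L, K \in T -> L \in T ->
        hull K `&` hull L = hull (K `&` L)%fset].

Definition diam A : R :=
  sup [set r | exists x y, [/\ A x, A y & r = enorm (x - y)]].

Definition inradius A : R :=
  sup [set r | 0 <= r /\ exists x, forall y, enorm (y - x) <= r -> A y].

Definition regular_family (I : Type) (T : I -> {fset {fset 'rV[R]_n}}) : Prop :=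
  exists sigma : R, forall (h : I) K, K \in T h ->
    diam (hull K) <= sigma * inradius (hull K).

Definition quasi_uniform_family (I : Type) (T : I -> {fset {fset 'rV[R]_n}}) :=
  regular_family T /\ exists2 c : R, 0 < c &
    forall (h : I) K L, K \in T h -> L \in T h ->
      c * diam (hull L) <= diam (hull K).

Definition P1space Om T :=
  [set u : 'rV[R]_n -> R | {within closure Om, continuous u} /\
     forall K, K \in T -> exists (a : 'I_n -> R) (b : R),
       forall x, hull K x -> u x = b + \sum_i a i * x 0 i].

Definition Vh Om T : set ('rV[R]_n -> 'rV[R]_n) :=
  vspace (H10 Om) `&` vspace (P1space Om T).

Definition Qh Om T : set ('rV[R]_n -> R) := L20 Om `&` P1space Om T.

Definition Wh (d : nat) (W : set ('rV[R]_n -> 'rV[R]_d)) Om T :=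
  W `&` vspace (P1space Om T).

Definition Lambdah (d : nat) Om T : set ('rV[R]_n -> 'rV[R]_d) :=
  vspace (P1space Om T).

Definition stab_form Om T (gamma : R) (p q : 'rV[R]_n -> R) : R :=
  gamma * \sum_(K <- T)
    diam (hull K) ^+ 2 * L2prodM (hull K) (grad Om p) (grad Om q).

Definition stab_seminorm Om T (gamma : R) (q : 'rV[R]_n -> R) : R :=
  Num.sqrt (stab_form Om T gamma q q).

End finite_elements.

Section time_stepping.
Context {R : realType} {V : lmodType R}.
Implicit Types (tau : R) (g : int -> V) (m : int).

Definition dtau tau g : int -> V := fun m => tau^-1 *: (g m - g (m - 1)).

Definition dtau2 tau g : int -> V :=
  fun m => (tau ^+ 2)^-1 *: (g m - 2 *: g (m - 1) + g (m - 2)).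

End time_stepping.

Section energy.
Context {R : realType} (d : nat).
Variables (Om : set 'rV[R]_d) (Sg : set 'rV[R]_d.-1).
Variable a_s :
  ('rV[R]_d.-1 -> 'rV[R]_d) -> ('rV[R]_d.-1 -> 'rV[R]_d) -> R.

Definition snorm w : R := Num.sqrt (a_s w w).

Definition energy (rho_f rho_s eps tau : R) (u : int -> 'rV[R]_d -> 'rV[R]_d)
    (dh : int -> 'rV[R]_d.-1 -> 'rV[R]_d) (m : int) : R :=
  rho_f / 2 * L2normM Om (u m) ^+ 2 +
  rho_s * eps / 2 * L2normM Sg (dtau tau dh m) ^+ 2 +
  2^-1 * snorm (dh m) ^+ 2.

Definition dissipation (rho_f rho_s eps mu tau gamma : R)
    (T : {fset {fset 'rV[R]_d}}) (u : int -> 'rV[R]_d -> 'rV[R]_d)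
    (p : int -> 'rV[R]_d -> R) (dh : int -> 'rV[R]_d.-1 -> 'rV[R]_d)
    (n : nat) : R :=
  tau * \sum_(1 <= k < n.+1)
    (2 * mu * L2normM Om (strain Om (u k)) ^+ 2 +
     stab_seminorm Om T gamma (p k) ^+ 2) +
  tau ^+ 2 * \sum_(1 <= k < n.+1)
    (rho_f / 2 * L2normM Om (dtau tau u k) ^+ 2 +
     rho_s * eps / 2 * L2normM Sg (dtau tau (dtau tau dh) k) ^+ 2 +
     2^-1 * snorm (dtau tau dh k) ^+ 2).

End energy.

(* Main.v *)
(* At each step, test with [v_h = u_h^m], [w_h = dtau d_h^m],
   [mu_h = lambda_h^m], [q_h = p_h^m]: the pressure and multiplier terms cancel,
   and the discrete chain rule for the three quadratic forms turns the sum into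
   an exact energy increment; summation over the steps telescopes. The analytic
   point is that the coupling term [c(lambda, u o phi - dtau d)] may be split
   and the L^2 products expanded, i.e. that all integrands are integrable: they are
   bounded, by compactness of the closed polygonal domains, and measurable on
   sets of finite measure. *)
Require Import Defs.
From mathcomp Require Import all_boot all_order all_algebra finmap.
From mathcomp Require Import all_classical all_reals all_analysis.
From mathcomp Require Import measurable_realfun ring lra.

Set Implicit Arguments.
Unset Strict Implicit.
Unset Printing Implicit Defensive.

Import Order.TTheory GRing.Theory Num.Theory numFieldNormedType.Exports.

Local Open Scope classical_set_scope.
Local Open Scope ring_scope.

(** * Borel sets of R^n and finiteness of Lebesgue measure on bounded sets *)

Section borel_rV.
Context {R : realType}.

Lemma ler_coord_norm n (x : 'rV[R]_n) i : `|x 0 i| <= `|x|.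
Proof.
rewrite [leRHS]/Num.Def.normr /= mx_normrE; apply/bigmax_geP.
by right; exists (0, i).
Qed.

Lemma measurable_cube n (c : 'I_n -> set (measurableTypeR R)) :
  (forall i, measurable (c i)) ->
  measurable [set x : 'rV[R]_n | forall i, c i (x 0 i)].
Proof.
move=> mc; rewrite (_ : mkset _ = \bigcap_(i in setT) (coord_rV i @^-1` c i)).
  apply: fin_bigcap_measurable => [|i _]; first exact: (@finite_finset _ setT).
  by rewrite -[X in measurable X]setTI; apply: measurable_coord_rV.
apply/seteqP; split=> x cx i; first by move=> _; exact: cx.
exact: (cx i I).
Qed.

(** Since the sigma-algebra is generated by coordinates, an open set is exhausted by the countably
    many open cubes with rational centre and radius that it contains. *)
Lemma open_measurable_rV n (U : set 'rV[R]_n) : open U -> measurable U.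
Proof.
move=> oU.
pose cube (p : 'rV[rat]_n * rat) := [set y : 'rV[R]_n |
  forall i, `](ratr (p.1 0 i) - ratr p.2), (ratr (p.1 0 i) + ratr p.2)[%classic
            (y 0 i)].
(* A cube that leaves [U] is replaced by [set0], so that the union runs over a whole countable
   type. *)
rewrite (_ : U = \bigcup_(p in setT)
    (if `[< cube p `<=` U >] then cube p else set0)); last first.
  apply/seteqP; split=> [x Ux|x [p _]]; last first.
    by case: asboolP => // pU; apply: pU.
  have /nbhs_ballP[e /= e0 xeU] : nbhs x U by exact: open_nbhs_nbhs.
  (* With [r < e / 2] and a centre [q] within [r] of [x] in each coordinate, the cube contains [x]
     and its points lie within [2 r < e] of [x]. *)
  have [r] : exists r : rat, ratr r \in `]0, (e / 2)[%R.
    by apply: rat_in_itvoo; rewrite divr_gt0.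
  rewrite in_itv/= => /andP[r0 re].
  have /choice[q qx] : forall i, exists q : rat,
      ratr q \in `](x 0 i - ratr r), (x 0 i + ratr r)[%R.
    by move=> i; apply: rat_in_itvoo; lra.
  exists (\row_i q i, r) => //; case: asboolP => [_ i /=|[]].
    by rewrite mxE in_itv/=; move: (qx i); rewrite in_itv/=; lra.
  move=> y cy; apply: xeU; split=> // k i; rewrite (ord1 k).
  rewrite -ball_normE/= ltr_norml.
  by move: (cy i) (qx i); rewrite /= !in_itv/= mxE; lra.
apply: countable_bigcupT_measurable => // p.
case: asboolP => // _; apply: (@measurable_cube n (fun i =>
  `](ratr (p.1 0 i) - ratr p.2), (ratr (p.1 0 i) + ratr p.2)[%classic)) => i.
exact: measurable_itv.
Qed.

Definition cube_rV n (M : R) := [set x : 'rV[R]_n | forall i, `|x 0 i| <= M].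

Lemma measurable_cube_rV n (M : R) : measurable (@cube_rV n M).
Proof.
apply: (@measurable_cube n (fun=> [set y | `|y| <= M])) => _.
rewrite (_ : mkset _ = `[- M, M]%classic); first exact: measurable_itv.
by apply/seteqP; split=> y /=; rewrite in_itv/= ler_norml.
Qed.

(** The preimage of a cube under [cons_rV] is an interval times a lower-dimensional cube, so the
    recursion defining the measure gives an induction. *)
Lemma lebesgue_rV_cube_lty n (M : R) : (lebesgue_rV n (@cube_rV n M) < +oo)%E.
Proof.
elim: n => [|n ih] /=.
  by rewrite diracE; case: (_ \in _) => //=; rewrite ltry.
rewrite /lebesgue_rVS /pushforward.
rewrite (_ : _ @^-1` _ = `[- M, M]%classic `*` @cube_rV n M); last first.
  apply/seteqP; split=> -[t x] /=.
    move=> cx; split=> [|i]; last by have := cx (lift ord0 i); rewrite cons_rVS.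
    by have := cx ord0; rewrite cons_rV0 in_itv/= ler_norml.
  rewrite in_itv/= -ler_norml => -[tM xM] i.
  by have [j ->|->] := unliftP ord0 i; rewrite ?cons_rVS ?cons_rV0.
rewrite product_measure1E//; last exact: measurable_cube_rV.
rewrite lte_mul_pinfty//.
have : lebesgue_measure `[- M, M]%classic \is a fin_num.
  by rewrite lebesgue_measure_itv/=; case: ifP; rewrite -?EFinB.
exact.
Qed.

Lemma lebesgue_rV_bounded_lty n (A : set 'rV[R]_n) :
  measurable A -> bounded_set A -> (lebesgue_rV n A < +oo)%E.
Proof.
move=> mA [M [_ AM]].
(* [bounded_set] only provides bounds strictly above [M], hence [M + 1]. *)
apply: le_lt_trans (lebesgue_rV_cube_lty n (M + 1)).
apply: le_measure; rewrite ?inE//.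
  exact: measurable_cube_rV.
move=> x Ax i; apply: le_trans (ler_coord_norm x i) _.
by apply: AM; rewrite // ltrDl.
Qed.

End borel_rV.

(** * Polygonal domains: compact closure and finite measure *)

Section polygonal.
Context {R : realType} {n : nat}.
Implicit Types (Om : set 'rV[R]_n) (T : {fset {fset 'rV[R]_n}}).

(** Balls are convex: the triangle inequality is applied to a convex combination of the vertices. *)
Lemma hull_norm_le (K : {fset 'rV[R]_n}) (M : R) (x : 'rV[R]_n) :
  (forall v, v \in K -> `|v| <= M) -> hull K x -> `|x| <= M.
Proof.
move=> KM [a [a0 a1 ->]]; rewrite -[leRHS]mul1r -a1 mulr_suml.
apply: le_trans (ler_norm_sum _ _ _) _.
rewrite big_seq [leRHS]big_seq; apply: ler_sum => v vK.
by rewrite normrZ ger0_norm ?a0// ler_wpM2l ?a0// KM.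
Qed.

Lemma bounded_union_hull T : bounded_set (union_hull T).
Proof.
(* The sum of all vertex norms dominates each of them. *)
exists (\sum_(K <- T) \sum_(v <- K) `|v|); split=> [|M ltM x [K KT]].
  exact: num_real.
apply: hull_norm_le => v vK; apply: le_trans (ltW ltM).
rewrite (big_rem K)//= (big_rem v)//= -addrA lerDl addr_ge0//.
  exact: sumr_ge0.
by apply: sumr_ge0 => L _; exact: sumr_ge0.
Qed.

Lemma polygonal_bounded_closure Om : polygonal_domain Om ->
  bounded_set (closure Om).
Proof. by case=> _ _ _ _ [T [_ ->]]; exact: bounded_union_hull. Qed.

Lemma polygonal_compact_closure Om : polygonal_domain Om ->
  compact (closure Om).
Proof.
move=> pOm; apply: bounded_closed_compact; last exact: closed_closure.
exact: polygonal_bounded_closure.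
Qed.

Lemma polygonal_measurable Om : polygonal_domain Om -> measurable Om.
Proof. by case=> _ oOm _ _ _; exact: open_measurable_rV. Qed.

Lemma polygonal_lebesgue_lty Om : polygonal_domain Om ->
  (lebesgue_rV n Om < +oo)%E.
Proof.
move=> pOm; apply: lebesgue_rV_bounded_lty; first exact: polygonal_measurable.
have [M [Mr OmM]] := polygonal_bounded_closure pOm.
by exists M; split=> // e Me x Omx; apply: OmM Me _ _; exact: subset_closure.
Qed.

End polygonal.

(** * An algebra of integrable functions *)

Section bounded_measurable.
Context {R : realType} d (T : measurableType d).
Implicit Types (A : set T) (f g : T -> R).

(** This class is closed under the sums and products in the integrands, and its members are
    integrable over measurable sets of finite measure. *)
Definition bounded_measurable A f :=
  measurable_fun A f /\ exists M : R, forall x, A x -> `|f x| <= M.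

Lemma bounded_measurable_linear A (a : R) f g : bounded_measurable A f ->
  bounded_measurable A g -> bounded_measurable A (fun x => a * f x + g x).
Proof.
move=> [mf [M fM]] [mg [N gN]]; split.
  by apply: measurable_funD => //; apply: measurable_funM.
exists (`|a| * M + N) => x Ax; apply: le_trans (ler_normD _ _) _.
by rewrite normrM lerD ?gN// ler_wpM2l ?fM.
Qed.

Lemma bounded_measurableM A f g : bounded_measurable A f ->
  bounded_measurable A g -> bounded_measurable A (fun x => f x * g x).
Proof.
move=> [mf [M fM]] [mg [N gN]]; split; first exact: measurable_funM.
by exists (M * N) => x Ax; rewrite normrM ler_pM ?fM ?gN.
Qed.

Lemma bounded_measurable_sum A (I : finType) (f_ : I -> T -> R) :
  (forall i, bounded_measurable A (f_ i)) ->
  bounded_measurable A (fun x => \sum_i f_ i x).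
Proof.
move=> bf; split; first by apply: measurable_sum => i; have [] := bf i.
have /choice[M fM] i := (bf i).2.
exists (\sum_i M i) => x Ax; apply: le_trans (ler_norm_sum _ _ _) _.
by apply: ler_sum => i _; exact: fM.
Qed.

Lemma bounded_measurable_integrable A f (mu : {measure set T -> \bar R}) :
  measurable A -> (mu A < +oo)%E -> bounded_measurable A f ->
  mu.-integrable A (EFin \o f).
Proof.
move=> mA Aoo [mf [M fM]]; apply: measurable_bounded_integrable => //.
exists M; split=> [|N MN x Ax]; first exact: num_real.
by apply: le_trans (fM _ Ax) (ltW MN).
Qed.

End bounded_measurable.

Lemma bounded_measurable_comp (R : realType) d (T : measurableType d)
    d' (T' : measurableType d') (A : set T) (B : set T') (f : T -> R)
    (g : T' -> T) : measurable A -> g @` B `<=` A -> measurable_fun B g ->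
  bounded_measurable A f -> bounded_measurable B (f \o g).
Proof.
move=> mA gB mg [mf [M fM]]; split; first exact: measurable_comp mf mg.
by exists M => x Bx; apply: fM; apply: gB; exists x.
Qed.

(** * Finite element functions *)

Section P1.
Context {R : realType} {n : nat}.
Implicit Types (A Om : set 'rV[R]_n) (T : {fset {fset 'rV[R]_n}}).

Lemma open_continuous_measurable_rV A (f : 'rV[R]_n -> R) : open A ->
  {in A, continuous f} -> measurable_fun A f.
Proof.
move=> oA /(continuous_inP _ oA) cf.
apply: (measurability _ (RGenOpens.measurableE R)) => _ [_ [a [b ->] <-]].
by apply: open_measurable_rV; apply: cf; exact: interval_open.
Qed.

(** Continuity on the compact closure gives the bound; restricted to the open set [Om] it gives
    measurability. *)
Lemma P1space_bounded_measurable Om T (u : 'rV[R]_n -> R) :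
  polygonal_domain Om -> P1space Om T u -> bounded_measurable Om u.
Proof.
move=> pOm [cu _]; have [_ oOm _ _ _] := pOm; split.
  apply: open_continuous_measurable_rV => //.
  rewrite -continuous_open_subspace//.
  by apply: continuous_subspaceW cu; exact: subset_closure.
have [M [_ uM]] := compact_bounded
  (continuous_compact cu (polygonal_compact_closure pOm)).
exists (M + 1) => x Omx; apply: uM; first by rewrite ltrDl.
by exists x => //; exact: subset_closure.
Qed.

Lemma P1space_linear Om T (a : R) (u v : 'rV[R]_n -> R) :
  P1space Om T u -> P1space Om T v -> P1space Om T (a *: u + v).
Proof.
move=> [cu au] [cv av]; split.
  by move=> x; apply: cvgD; [apply: cvgZr; exact: cu|exact: cv].
move=> K KT; have [b [b0 ub]] := au K KT; have [c [c0 vc]] := av K KT.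
exists (fun i => a * b i + c i), (a * b0 + c0) => x Kx.
rewrite /= (_ : (a *: u + v) x = a * u x + v x)// ub// vc//.
under [in RHS]eq_bigr do rewrite mulrDl -mulrA.
by rewrite big_split/= -mulr_sumr; ring.
Qed.

End P1.

(** The sets whose preimage has a measurable trace on [D] form a sigma-algebra containing the
    coordinate generators. This relative form suits [phi0], which is measurable on [Sg] only. *)
Lemma measurable_fun_rV_in (R : realType) n d (T : measurableType d)
    (D : set T) (f : T -> 'rV[R]_n) :
  (forall i, measurable_fun D (coord_rV i \o f)) -> measurable_fun D f.
Proof.
move=> mf mD A mA.
suff sub : g_sigma_preimage (@coord_rV R n)
    `<=` [set B | measurable (D `&` f @^-1` B)] by exact: sub.
apply: smallest_sub.
  split=> [|B /= mB|F mF] /=; first by rewrite preimage_set0 setI0.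
  - rewrite (_ : _ `&` _ = D `\` (D `&` f @^-1` B)); first exact: measurableD.
    apply/seteqP; split=> x /= [Dx].
      by move=> [_ nB]; split=> // -[_ /nB].
    by move=> nB; split=> //; split=> // Bx; apply: nB.
  - rewrite preimage_bigcup setI_bigcupr.
    by apply: bigcup_measurable => k _; exact: mF.
rewrite -bigcup_seq => B [i /= _] [C mC <-].
by rewrite setTI -comp_preimage; exact: mf.
Qed.

(** * Bilinearity of the L^2 products *)

Section L2prodM.
Context {R : realType} {n p q : nat}.
Implicit Types (A : set 'rV[R]_n) (F G H : 'rV[R]_n -> 'M[R]_(p, q)).

Lemma L2prodMC A F G : L2prodM A F G = L2prodM A G F.
Proof.
apply: eq_Rintegral => x _; apply: eq_bigr => i _; apply: eq_bigr => j _.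
exact: mulrC.
Qed.

Lemma L2prodM_ge0 A F : 0 <= L2prodM A F F.
Proof.
apply: Rintegral_ge0 => x _; apply: sumr_ge0 => i _; apply: sumr_ge0 => j _.
by rewrite -expr2 sqr_ge0.
Qed.

Lemma L2normM_sqr A F : L2normM A F ^+ 2 = L2prodM A F F.
Proof. by rewrite sqr_sqrtr// L2prodM_ge0. Qed.

Definition entries_bounded_measurable A F :=
  forall i j, bounded_measurable A (fun x => F x i j).

Lemma entries_bounded_measurable_linear A (a : R) F G :
  entries_bounded_measurable A F -> entries_bounded_measurable A G ->
  entries_bounded_measurable A (a *: F + G).
Proof.
move=> bF bG i j.
rewrite (_ : (fun x => _) = fun x => a * F x i j + G x i j).
  exact: bounded_measurable_linear.
by apply/funext => x; rewrite !mxE.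
Qed.

(** Additivity of the integral requires integrable terms, which bounded measurable entries on a set
    of finite measure supply. *)
Lemma L2prodM_linear A (a : R) F G H :
  measurable A -> (lebesgue_rV n A < +oo)%E ->
  entries_bounded_measurable A F -> entries_bounded_measurable A G ->
  entries_bounded_measurable A H ->
  L2prodM A (a *: F + G) H = a * L2prodM A F H + L2prodM A G H.
Proof.
move=> mA Aoo bF bG bH.
have intP F' : entries_bounded_measurable A F' -> (lebesgue_rV n).-integrable A
    (EFin \o (fun x => \sum_i \sum_j F' x i j * H x i j)).
  move=> bF'; apply: bounded_measurable_integrable => //.
  do 2 apply: bounded_measurable_sum => ?.
  exact: bounded_measurableM.
rewrite /L2prodM -RintegralZl//; last exact: intP.
rewrite -RintegralD//; first last.
- exact: intP.
- apply: (bounded_measurable_integrable _ _ _) => //.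
  (* Adding the zero function brings the scalar multiple into the form [a * f + g]. *)
  rewrite [X in bounded_measurable _ X](_ : _ = fun x =>
      a * (\sum_i \sum_j F x i j * H x i j) + 0); last first.
    by apply/funext => x; rewrite addr0.
  apply: bounded_measurable_linear; last first.
    by split=> //; exists 0 => x _; rewrite normr0.
  do 2 apply: bounded_measurable_sum => ?.
  exact: bounded_measurableM.
apply: eq_Rintegral => x _.
rewrite mulr_sumr -big_split/=; apply: eq_bigr => i _.
rewrite mulr_sumr -big_split/=; apply: eq_bigr => j _.
by rewrite !mxE mulrDl mulrA.
Qed.

End L2prodM.

Lemma vspaceP1_bounded_measurable (R : realType) n d (Om : set 'rV[R]_n)
    (T : {fset {fset 'rV[R]_n}}) (v : 'rV[R]_n -> 'rV[R]_d) :
  polygonal_domain Om -> vspace (P1space Om T) v ->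
  entries_bounded_measurable Om v.
Proof.
move=> pOm vP i j; rewrite (ord1 i).
exact: P1space_bounded_measurable pOm (vP j).
Qed.

Lemma vspaceP1_linear (R : realType) n d (Om : set 'rV[R]_n)
    (T : {fset {fset 'rV[R]_n}}) (a : R) (v w : 'rV[R]_n -> 'rV[R]_d) :
  vspace (P1space Om T) v -> vspace (P1space Om T) w ->
  vspace (P1space Om T) (a *: v + w).
Proof.
move=> vP wP j.
rewrite (_ : comp_rV j _ = a *: comp_rV j v + comp_rV j w).
  exact: P1space_linear.
by apply/funext => x; rewrite /comp_rV !mxE.
Qed.

(** This makes the velocity on the moving solid an admissible integrand: the position map is
    measurable coordinate by coordinate, and its image stays where [v] is bounded. *)
Lemma entries_bounded_measurable_comp (R : realType) n k d
    (Om : set 'rV[R]_n) (Sg : set 'rV[R]_k)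
    (v : 'rV[R]_n -> 'rV[R]_d) (phi0 w : 'rV[R]_k -> 'rV[R]_n) :
  measurable Om -> measurable_fun Sg phi0 ->
  entries_bounded_measurable Sg w -> (phi0 + w) @` Sg `<=` Om ->
  entries_bounded_measurable Om v ->
  entries_bounded_measurable Sg (v \o (phi0 + w)).
Proof.
move=> mOm mphi0 bw phiOm bv i j.
apply: (bounded_measurable_comp (A := Om) (f := fun x => v x i j)
  (g := phi0 + w)) => //.
apply: measurable_fun_rV_in => l.
rewrite (_ : _ \o _ = (coord_rV l \o phi0) \+ (fun x => w x 0 l)); last first.
  by apply/funext => x; rewrite /= /coord_rV mxE.
apply: measurable_funD; last by have [] := bw 0 l.
by apply: measurableT_comp => //; exact: measurable_coord_rV.
Qed.

(** * Discrete chain rule for quadratic forms *)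

Section difference_quotient.
Context {R : realType} {V : lmodType R} (P : set V).
Hypothesis P_linear : forall (a : R) u v, P u -> P v -> P (a *: u + v).

Lemma difference_quotient_in (a : R) x y : P x -> P y -> P (a *: (x - y)).
Proof.
move=> Px Py; have Pxy : P (x - y) by rewrite addrC -scaleN1r; exact: P_linear.
(* A multiple [a z] is written [(a - 1) z + z] to match the closure property of [P]. *)
by rewrite -[a](subrK 1) scalerDl scale1r; exact: P_linear.
Qed.

(* From [y = x - tau dxy] one gets
   [2 tau B(dxy, x) = B(x, x) - B(y, y) + tau^2 B(dxy, dxy)]: the last term is
   the numerical dissipation of the implicit Euler scheme. *)
Lemma bilinear_difference_quotient (B : V -> V -> R) (tau : R) x y :
  (forall (a : R) u v w, P u -> P v -> P w ->
     B (a *: u + v) w = a * B u w + B v w) ->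
  (forall u v, P u -> P v -> B u v = B v u) ->
  tau != 0 -> P x -> P y ->
  let dxy := tau^-1 *: (x - y) in
  tau * B dxy x = 2^-1 * B x x - 2^-1 * B y y + tau ^+ 2 * (2^-1 * B dxy dxy).
Proof.
move=> linB symB tau0 Px Py dxy.
have Pd : P dxy by exact: difference_quotient_in.
have yE : y = - tau *: dxy + x.
  by rewrite scaleNr scalerA divff// scale1r opprB subrK.
have -> : B y y = B x x - 2 * tau * B dxy x + tau ^+ 2 * B dxy dxy.
  rewrite {1}yE linB// (symB x y)// (symB dxy y)// yE !linB// (symB x dxy)//.
  ring.
by field.
Qed.

End difference_quotient.

(** The algebra of one step. Primed quantities belong to the previous time level, and [k] stands for
    the solid inertia coefficient [rho_s * eps]. *)
Lemma energy_balance (R : realFieldType) (tau rho_f k mu : R)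
    (uu uu' duu vv vv' dvv aa aa' daa duu_u dvv_v daa_a visc : R)
    (pdiv stab lam : R) :
  tau * duu_u = 2^-1 * uu - 2^-1 * uu' + tau ^+ 2 * (2^-1 * duu) ->
  tau * dvv_v = 2^-1 * vv - 2^-1 * vv' + tau ^+ 2 * (2^-1 * dvv) ->
  tau * daa_a = 2^-1 * aa - 2^-1 * aa' + tau ^+ 2 * (2^-1 * daa) ->
  rho_f * duu_u + 2 * mu * visc - pdiv + lam = 0 ->
  k * dvv_v + daa_a - lam = 0 -> pdiv + stab = 0 ->
  rho_f / 2 * uu + k / 2 * vv + 2^-1 * aa + tau * (2 * mu * visc + stab)
  + tau ^+ 2 * (rho_f / 2 * duu + k / 2 * dvv + 2^-1 * daa)
  = rho_f / 2 * uu' + k / 2 * vv' + 2^-1 * aa'.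
Proof.
move=> ueq veq aeq fluid solid incompr.
have -> : uu = uu' + 2 * (tau * duu_u) - tau ^+ 2 * duu by rewrite ueq; field.
have -> : vv = vv' + 2 * (tau * dvv_v) - tau ^+ 2 * dvv by rewrite veq; field.
have -> : aa = aa' + 2 * (tau * daa_a) - tau ^+ 2 * daa by rewrite aeq; field.
(* Adding the three tested equations cancels [pdiv] and [lam]. *)
have -> : stab = - (rho_f * duu_u + 2 * mu * visc + k * dvv_v + daa_a) by lra.
by field.
Qed.

(** * Energy identity for the scheme *)

Theorem theorem2p4p2 (R : realType) (d : nat) (hd : d = 2%N \/ d = 3%N)
  (Om : set 'rV[R]_d) (hOm : polygonal_domain Om)
  (Sg : set 'rV[R]_d.-1) (hSg : polygonal_domain Sg)
  (phi0 : 'rV[R]_d.-1 -> 'rV[R]_d) (hphi0 : measurable_fun Sg phi0)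
  (hphi0Om : phi0 @` Sg `<=` Om)
  (rho_f rho_s eps mu gamma tau : R) (hrho_f : 0 < rho_f) (hrho_s : 0 < rho_s)
  (heps : 0 < eps) (hmu : 0 < mu) (hgamma : 0 < gamma) (htau : 0 < tau)
  (W : set ('rV[R]_d.-1 -> 'rV[R]_d)) (hW : closed_subspace_H1 Sg W)
  (a_s : ('rV[R]_d.-1 -> 'rV[R]_d) -> ('rV[R]_d.-1 -> 'rV[R]_d) -> R)
  (ha_s : solid_form Sg W a_s)
  (I : Type)
  (T : I -> {fset {fset 'rV[R]_d}}) (hT : forall h, triangulation Om (T h))
  (hTreg : regular_family T)
  (S : I -> {fset {fset 'rV[R]_d.-1}}) (hS : forall h, triangulation Sg (S h))
  (hSqu : quasi_uniform_family S)
  (h : I) (n : nat) (hn : (1 <= n)%N)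
  (u0h : 'rV[R]_d -> 'rV[R]_d) (hu0h : Vh Om (T h) u0h)
  (d0h d1h : 'rV[R]_d.-1 -> 'rV[R]_d)
  (hd0h : Wh W Sg (S h) d0h) (hd1h : Wh W Sg (S h) d1h)
  (uh : int -> 'rV[R]_d -> 'rV[R]_d) (ph : int -> 'rV[R]_d -> R)
  (dh lambdah : int -> 'rV[R]_d.-1 -> 'rV[R]_d)
  (huh0 : uh 0 = u0h) (hdh0 : dh 0 = d0h) (hdh1 : dh (-1) = d0h - tau *: d1h)
  (hspaces : forall m : nat, (1 <= m <= n)%N ->
     [/\ Vh Om (T h) (uh m), Qh Om (T h) (ph m), Wh W Sg (S h) (dh m) &
         Lambdah Sg (S h) (lambdah m)])
  (hphi : forall m : nat, (m < n)%N -> (phi0 + dh m) @` Sg `<=` Om)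
  (hfluid : forall m : nat, (1 <= m <= n)%N ->
     forall vh, Vh Om (T h) vh ->
       rho_f * L2prodM Om (dtau tau uh m) vh
       + 2 * mu * L2prodM Om (strain Om (uh m)) (strain Om vh)
       - L2prod Om (divergence Om vh) (ph m)
       + L2prodM Sg (lambdah m) (vh \o (phi0 + dh (m%:Z - 1))) = 0)
  (hsolid : forall m : nat, (1 <= m <= n)%N ->
     forall wh, Wh W Sg (S h) wh ->
       rho_s * eps * L2prodM Sg (dtau2 tau dh m) wh
       + a_s (dh m) wh - L2prodM Sg (lambdah m) wh = 0)
  (hcoupling : forall m : nat, (1 <= m <= n)%N ->
     forall muh, Lambdah Sg (S h) muh ->
       L2prodM Sg muh (uh m \o (phi0 + dh (m%:Z - 1)) - dtau tau dh m) = 0)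
  (hincompr : forall m : nat, (1 <= m <= n)%N ->
     forall qh, Qh Om (T h) qh ->
       L2prod Om (divergence Om (uh m)) qh
       + stab_form Om (T h) gamma (ph m) qh = 0) :
  energy Om Sg a_s rho_f rho_s eps tau uh dh n
  + dissipation Om Sg a_s rho_f rho_s eps mu tau gamma (T h) uh ph dh n
  = energy Om Sg a_s rho_f rho_s eps tau uh dh 0.
Proof.
have tau0 : tau != 0 by rewrite gt_eqF.
have [_ _ W_linear _] := hW.
have [a_lin a_sym _ [alpha alpha0 a_coer]] := ha_s.
have [mOm Omoo] := (polygonal_measurable hOm, polygonal_lebesgue_lty hOm).
have [mSg Sgoo] := (polygonal_measurable hSg, polygonal_lebesgue_lty hSg).
(* Coercivity makes [a_s w w] nonnegative on [W], so the square root is genuine. *)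
have snormE w : W w -> snorm a_s w ^+ 2 = a_s w w.
  move=> Ww; rewrite sqr_sqrtr// (le_trans _ (a_coer w Ww))//.
  by rewrite mulr_ge0 ?(ltW alpha0) ?sqr_ge0.
have stab_seminormE q :
    stab_seminorm Om (T h) gamma q ^+ 2 = stab_form Om (T h) gamma q q.
  rewrite sqr_sqrtr// mulr_ge0 ?(ltW hgamma)// sumr_ge0// => K _.
  by rewrite mulr_ge0 ?sqr_ge0 ?L2prodM_ge0.
have Wh_linear (a : R) w z : Wh W Sg (S h) w -> Wh W Sg (S h) z ->
    Wh W Sg (S h) (a *: w + z).
  by move=> [? ?] [? ?]; split; [exact: W_linear|exact: vspaceP1_linear].
have uhV (m : nat) : (m <= n)%N -> Vh Om (T h) (uh m).
  by case: m => [_|m mn]; [rewrite huh0|have [] := hspaces m.+1 mn].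
have dhW (m : nat) : (m <= n)%N -> Wh W Sg (S h) (dh m).
  by case: m => [_|m mn]; [rewrite hdh0|have [] := hspaces m.+1 mn].
(* The level [-1] enters through the initial solid velocity, the difference quotient at level 0. *)
have dh1W : Wh W Sg (S h) (dh (-1)).
  by rewrite hdh1 addrC -scaleNr; exact: Wh_linear.
have predE (m : nat) : m.+1%:Z - 1 = m by rewrite -addn1 PoszD addrK.
have ddhW (m : nat) : (m <= n)%N -> Wh W Sg (S h) (dtau tau dh m).
  case: m => [_|m mn]; apply: difference_quotient_in => //.
  - exact: (dhW 0%N).
  - exact: (dhW m.+1).
  - by rewrite predE; exact: dhW (ltnW mn).
have step (m : nat) : (m < n)%N ->
  energy Om Sg a_s rho_f rho_s eps tau uh dh m.+1
  + tau * (2 * mu * L2normM Om (strain Om (uh m.+1)) ^+ 2 +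
     stab_seminorm Om (T h) gamma (ph m.+1) ^+ 2)
  + tau ^+ 2 * (rho_f / 2 * L2normM Om (dtau tau uh m.+1) ^+ 2 +
     rho_s * eps / 2 * L2normM Sg (dtau tau (dtau tau dh) m.+1) ^+ 2 +
     2^-1 * snorm a_s (dtau tau dh m.+1) ^+ 2)
  = energy Om Sg a_s rho_f rho_s eps tau uh dh m.
  move=> mn.
  have [um uSm] := (uhV m (ltnW mn), uhV m.+1 mn).
  have [dm dSm] := (dhW m (ltnW mn), dhW m.+1 mn).
  have [ddm ddSm] := (ddhW m (ltnW mn), ddhW m.+1 mn).
  have [_ pSm _ lSm] := hspaces m.+1 mn.
  have bOm v : Vh Om (T h) v -> entries_bounded_measurable Om v.
    by case=> _; exact: vspaceP1_bounded_measurable.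
  have bSg w : Wh W Sg (S h) w -> entries_bounded_measurable Sg w.
    by case=> _; exact: vspaceP1_bounded_measurable.
  have fluid := hfluid m.+1 mn _ uSm.
  have solid := hsolid m.+1 mn _ ddSm.
  have coupling := hcoupling m.+1 mn _ lSm.
  have incompr := hincompr m.+1 mn _ pSm.
  (* Splitting the constraint tested with the multiplier identifies the coupling terms of fluid and
     solid. Symmetry first moves the difference into the first argument, where linearity is
     available. *)
  have coupling' :
      L2prodM Sg (lambdah m.+1) (uh m.+1 \o (phi0 + dh (m.+1%:Z - 1)))
      = L2prodM Sg (lambdah m.+1) (dtau tau dh m.+1).
    move: coupling; rewrite L2prodMC addrC -scaleN1r L2prodM_linear//.
    - by rewrite !(L2prodMC _ _ (lambdah _)) mulN1r addrC => /subr0_eq.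
    - exact: bSg.
    (* The geometry lags one step behind: the map is [phi0 + dh m] with [m < n], whose image lies in
       [Om] by [hphi]. *)
    - apply: entries_bounded_measurable_comp mOm hphi0 _ _ _.
      + by rewrite predE; exact: bSg.
      + by rewrite predE; exact: hphi.
      + exact: bOm.
    - exact: vspaceP1_bounded_measurable hSg lSm.
  (* The chain rule is used three times: for the fluid velocity and the solid velocity on functions
     with bounded measurable entries, then for the displacement on [W]. *)
  have u_inc := @bilinear_difference_quotient R _
    (entries_bounded_measurable Om)
    (@entries_bounded_measurable_linear _ _ _ _ Om)
    (L2prodM Om) tau (uh m.+1) (uh m)
    (fun a u v w => @L2prodM_linear _ _ _ _ _ a u v w mOm Omoo)
    (fun u v _ _ => L2prodMC _ u v) tau0 (bOm _ uSm) (bOm _ um).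
  have dd_inc := @bilinear_difference_quotient R _
    (entries_bounded_measurable Sg)
    (@entries_bounded_measurable_linear _ _ _ _ Sg)
    (L2prodM Sg) tau (dtau tau dh m.+1) (dtau tau dh m)
    (fun a u v w => @L2prodM_linear _ _ _ _ _ a u v w mSg Sgoo)
    (fun u v _ _ => L2prodMC _ u v) tau0 (bSg _ ddSm) (bSg _ ddm).
  have d_inc := @bilinear_difference_quotient R _ W W_linear a_s tau
    (dh m.+1) (dh m) a_lin a_sym tau0 dSm.1 dm.1.
  have duE : dtau tau uh m.+1 = tau^-1 *: (uh m.+1 - uh m).
    by rewrite /dtau predE.
  have ddE : dtau tau dh m.+1 = tau^-1 *: (dh m.+1 - dh m).
    by rewrite /dtau predE.
  have dddE : dtau tau (dtau tau dh) m.+1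
      = tau^-1 *: (dtau tau dh m.+1 - dtau tau dh m).
    by rewrite {1}/dtau predE.
  have dtau2E : dtau2 tau dh m.+1 = dtau tau (dtau tau dh) m.+1.
    rewrite dddE ddE /dtau2 predE /dtau -scalerBr scalerA -invfM -expr2.
    (* The oldest level is an integer index, equal to [-1] when [m] is 0. *)
    rewrite (_ : m.+1%:Z - 2 = m%:Z - 1); last by rewrite -predE; ring.
    by rewrite scaler_nat opprB addrA addrAC mulr2n opprD addrA.
  rewrite /= -duE in u_inc; rewrite /= -dddE in dd_inc.
  rewrite /= -ddE in d_inc; rewrite coupling' in fluid.
  (* Symmetry puts the difference quotient first, as in the chain rule. *)
  rewrite dtau2E (a_sym _ _ dSm.1 ddSm.1) in solid.
  rewrite -!(L2normM_sqr Om) in u_inc.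
  rewrite -!(L2normM_sqr Sg) in dd_inc.
  rewrite -!snormE in d_inc; [|exact: ddSm.1|exact: dm.1|exact: dSm.1].
  rewrite -stab_seminormE in incompr.
  rewrite -(L2normM_sqr Om (strain _ _)) in fluid.
  exact: energy_balance u_inc dd_inc d_inc fluid solid incompr.
have regroup (e t1 s1 x1 t2 s2 x2 : R) : e + (t1 * (s1 + x1) + t2 * (s2 + x2))
    = e + t1 * x1 + t2 * x2 + (t1 * s1 + t2 * s2) by ring.
(* The claim is generalized to all levels up to [n] for the induction; at level 0 both dissipation
   sums are empty. *)
have main (m : nat) : (m <= n)%N ->
  energy Om Sg a_s rho_f rho_s eps tau uh dh m
  + dissipation Om Sg a_s rho_f rho_s eps mu tau gamma (T h) uh ph dh m
  = energy Om Sg a_s rho_f rho_s eps tau uh dh 0.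
  elim: m => [_|m ih mn].
    by rewrite /dissipation !big_geq// !mulr0 !addr0.
  rewrite -ih ?(ltnW mn)// -(step m mn) /dissipation.
  by rewrite !(big_nat_recr m.+1)//= regroup.
exact: main.
Qed.
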